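(* Let $I\subseteq S=\Bbbk[x_1,\ldots,x_n]$ be a monomial ideal over a field $\Bbbk$. For $\mathbf b\in\mathbb N^n$ and $\mathbf a=\mathbf b-\mathbf 1$, where $\mathbf 1=(1,\ldots,1)$, the Koszul simplicial complex of $S/I$ at $\mathbf b$ equals $$\mathrm{K}\Delta_{\mathbf b}=\{F\smallsetminus\mathrm{supp}(\mathbf a_-)\mid F\subseteq\{1,\ldots,n\},\ (S/I)_{\mathbf a+F}=\Bbbk\}.$$ Consequently, the Čech simplicial complex $\check{C}\Delta_{\mathbf a}$ of $I$ is a subcomplex of $\mathrm{K}\Delta_{\mathbf b}$.
   Context: Subsets $F\subseteq\{1,\ldots,n\}$ are identified with their characteristic $0/1$ vectors in $\mathbb N^n$. For $\mathbf a\in\mathbb Z^n$, $\mathrm{supp}(\mathbf a)=\{i\mid a_i\ne0\}$, and $\mathbf a=\mathbf a_+-\mathbf a_-$ is the decomposition into positive and negative parts (vectors in $\mathbb N^n$ with disjoint supports). A graded piece ''$=\Bbbk$'' means it is nonzero (one-dimensional); all rings carry the natural $\mathbb Z^n$-grading. For $\mathbf b\in\mathbb N^n$, set $\mathbf b'=\mathbf b-\mathrm{supp}(\mathbf b)$. The (lower) Koszul simplicial complex of $S/I$ in degree $\mathbf b$ is $$\mathrm{K}\Delta_{\mathbf b}=\{F\subseteq\mathrm{supp}(\mathbf b)\mid\mathbf x^{\mathbf b'+F}\notin I\}.$$ For $F\subseteq\{1,\ldots,n\}$, $S_F=S[x_i^{-1}\mid i\in F]$. The Čech simplicial complex of $I$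 in degree $\mathbf a\in\mathbb Z^n$ is $$\check{C}\Delta_{\mathbf a}=\{F\smallsetminus\mathrm{supp}(\mathbf a_-)\mid F\subseteq\{1,\ldots,n\},\ (S_F/IS_F)_{\mathbf a}=\Bbbk\}$$ (the condition forces $F\supseteq\mathrm{supp}(\mathbf a_-)$). *)

(* Defs.v *)
From HB Require Import structures.
From mathcomp Require Import all_boot all_order all_algebra.
From mathcomp Require Export mpoly.

Set Implicit Arguments.
Unset Strict Implicit.
Unset Printing Implicit Defensive.

Import Order.TTheory GRing.Theory Num.Theory.

Local Open Scope ring_scope.

(* Degrees in N^n are multinomials 'X_{1..n}; degrees in Z^n are finite
   functions.  The 0/1 characteristic vector of F : {set 'I_n}, as an element
   of N^n, is mesym1 F. *)
Notation zdegree n := {ffun 'I_n -> int}.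

Definition zdeg n (m : 'X_{1..n}) : zdegree n := [ffun i => (m i)%:Z].

Definition supp n (m : 'X_{1..n}) : {set 'I_n} := [set i | m i != 0%N].

(* The vector a_- of the decomposition a = a_+ - a_-. *)
Definition neg_part n (a : zdegree n) : 'X_{1..n} :=
  [multinom absz (Num.max 0 (- a i))%R | i < n].

(* The ideal generated by G in a subring A of R (meant for G included in A). *)
Definition ideal_gen (R : comNzRingType) (A G : R -> Prop) (z : R) : Prop :=
  exists r (s g : 'I_r -> R),
    [/\ forall j, A (s j), forall j, G (g j) & z = \sum_(j < r) s j * g j].

Definition monomial_ideal (k : fieldType) n (I : {mpoly k[n]} -> Prop) : Prop :=
  exists M : 'X_{1..n} -> Prop, forall p,
    I p <-> ideal_gen (fun=> True) (fun g => exists2 m, M m & g = 'X_[m]) p.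

(* For a k-subspace P of a ring R, with scalars acting through iota, the image
   of P in the quotient by J has dimension one. *)
Definition quotient_dim1 (k : fieldType) (R : comNzRingType) (iota : k -> R)
    (P J : R -> Prop) : Prop :=
  exists u, [/\ P u, ~ J u &
    forall v, P v -> exists c : k, J (v - iota c * u)].

Section Complexes.
Variables (k : fieldType) (n : nat).
Local Notation S := {mpoly k[n]}.
Local Notation frac := {fraction {mpoly k[n]}}.
Implicit Types (I : S -> Prop) (F G : {set 'I_n}) (a d : zdegree n).

Definition homogeneous d (p : S) : Prop := forall m, m \in msupp p -> zdeg m = d.

(* (S/I)_d is one-dimensional; it is 0 when d has a negative entry, since then
   homogeneous d contains only 0. *)
Definition quo_piece_is_k I d : Prop :=
  quotient_dim1 (@mpolyC n k) (homogeneous d) I.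

(* S_F = S[x_i^-1 | i in F], inside the fraction field of S. *)
Definition localized F (z : frac) : Prop :=
  exists (p : S) (m : 'X_{1..n}),
    supp m \subset F /\ z = tofrac p / tofrac 'X_[m].

Definition localized_ideal I F : frac -> Prop :=
  ideal_gen (localized F) (fun z => exists2 p, I p & z = tofrac p).

Definition frac_scalar (c : k) : frac := tofrac (c%:MP_[n]).

Definition laurent_monomial a : frac := \prod_(i < n) (tofrac 'X_i) ^ (a i).

Definition localized_homogeneous F a (z : frac) : Prop :=
  localized F z /\ exists c : k, z = frac_scalar c * laurent_monomial a.

(* (S_F / I S_F)_a is one-dimensional. *)
Definition localized_piece_is_k I F a : Prop :=
  quotient_dim1 frac_scalar (localized_homogeneous F a) (localized_ideal I F).

Definition koszul_complex I (b : 'X_{1..n}) F : Prop :=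
  F \subset supp b /\ ~ I 'X_[(b - mesym1 (supp b)) + mesym1 F].

Definition cech_complex I a G : Prop :=
  exists F, localized_piece_is_k I F a /\ G = F :\: supp (neg_part a).

(* The void complex, without faces, is allowed. *)
Definition simplicial_complex (D : {set 'I_n} -> Prop) : Prop :=
  forall F G, G \subset F -> D F -> D G.

Definition subcomplex (D E : {set 'I_n} -> Prop) : Prop :=
  [/\ simplicial_complex D, simplicial_complex E & forall F, D F -> E F].

End Complexes.

(* Main.v *)
Require Import Defs.
From mathcomp Require Import all_boot all_order all_algebra mpoly.
From mathcomp Require Import zify.
Import GRing.Theory Num.Theory.
Local Open Scope ring_scope.

(** A degree piece is one-dimensional exactly when its Laurent monomial lies in
    the ring but not in the ideal.  With [b' = b - supp b] and
    [N = supp a_- = ~: supp b], the degree [a + F] lies in [N^n] iff [N] is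
    contained in [F], and then it equals [b' + (F \ N)].  Since [x^F] is
    invertible in [S_F], [x^a] lies in [I S_F] as soon as [x^(b' + (F \ N))]
    lies in [I]. *)

Section IdealGen.

Variable R : comNzRingType.
Implicit Types (A G : R -> Prop).

Lemma ideal_gen0 A G : ideal_gen A G 0.
Proof. by exists 0%N, (fun=> 0), (fun=> 0); split=> [[]|[]|] //; rewrite big_ord0. Qed.

Lemma ideal_gen_mem A G s g : A s -> G g -> ideal_gen A G (s * g).
Proof. by move=> As Gg; exists 1%N, (fun=> s), (fun=> g); split; rewrite ?big_ord1. Qed.

Lemma ideal_genMl A G q z :
  (forall s, A s -> A (q * s)) -> ideal_gen A G z -> ideal_gen A G (q * z).
Proof.
move=> Aq [r [s [g [As Gg ->]]]]; exists r, (fun j => q * s j), g.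
by split=> [j|//|]; [exact/Aq | rewrite big_distrr /=; apply: eq_bigr => j _; rewrite mulrA].
Qed.

Lemma sub_ideal_gen A B G z :
  (forall s, A s -> B s) -> ideal_gen A G z -> ideal_gen B G z.
Proof. by move=> AB [r [s [g [As Gg ->]]]]; exists r, s, g; split=> // j; apply: AB. Qed.

End IdealGen.

Section Degrees.

Variable n : nat.
Implicit Types (F : {set 'I_n}) (a : zdegree n) (b p q m : 'X_{1..n}).

Lemma zdeg_inj : injective (@zdeg n).
Proof.
by move=> p q /ffunP pq; apply/mnmP => i; move: (pq i); rewrite !ffunE => -[].
Qed.

Lemma neg_partE a i : neg_part a i = if a i < 0 then absz (a i) else 0%N.
Proof. by rewrite mnmE Order.POrderTheory.maxElt oppr_gt0; case: ifP; lia. Qed.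

(** [neg_part (- a)] serves as a_+; this form lets [laurent_monomialB] turn any Laurent monomial
    into a quotient of two genuine monomials. *)
Lemma zdeg_pos_neg a : a = zdeg (neg_part (- a)) - zdeg (neg_part a).
Proof. by apply/ffunP => i; rewrite !ffunE !neg_partE !ffunE; case: (a i) => [[|m]|m] /=; lia. Qed.

Lemma supp_neg_part_sub1 b : supp (neg_part (zdeg b - [ffun=> 1])) = ~: supp b.
Proof. by apply/setP => i; rewrite !inE neg_partE !ffunE; case: (b i). Qed.

Lemma supp_mesym1 F : supp (mesym1 F) = F.
Proof. by apply/setP => i; rewrite !inE !mnmE; case: (i \in F). Qed.

(** Where b_i = 0, the entry -1 is cancelled by i in F; where b_i > 0, the truncated subtraction on
    the right is exact. *)
Lemma zdeg_sub1_mesym1 b F : ~: supp b \subset F ->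
  zdeg b - [ffun=> 1] + zdeg (mesym1 F) =
  zdeg (b - mesym1 (supp b) + mesym1 (F :\: ~: supp b))%MM.
Proof.
move=> /subsetP bF; apply/ffunP => i; move: (bF i).
by rewrite !ffunE !mnmE !inE; case: (i \in F); lia.
Qed.

(** An index outside both [supp b] and [F] would give the entry -1. *)
Lemma zdeg_sub1_mesym1_ge0 b F m :
  zdeg b - [ffun=> 1] + zdeg (mesym1 F) = zdeg m -> ~: supp b \subset F.
Proof.
move=> /ffunP bm; apply/subsetP => i; move: (bm i).
by rewrite !ffunE !mnmE !inE; case: (i \in F); lia.
Qed.

End Degrees.

Section Pieces.

Variables (k : fieldType) (n : nat).
Local Notation S := {mpoly k[n]}.
Local Notation frac := {fraction {mpoly k[n]}}.
Implicit Types (I : S -> Prop) (F G : {set 'I_n}) (a d : zdegree n).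
Implicit Types (p q m : 'X_{1..n}).

Lemma monomial_idealMl I (r s : S) : monomial_ideal I -> I s -> I (r * s).
Proof. by case=> M IM /IM Is; apply/IM/ideal_genMl. Qed.

Lemma monomial_ideal0 I : monomial_ideal I -> I 0.
Proof. by case=> M IM; apply/IM/ideal_gen0. Qed.

Lemma homogeneousX (u : S) m : homogeneous (zdeg m) u -> u = u@_m *: 'X_[m].
Proof.
move=> hu; apply/mpolyP => p; rewrite mcoeffZ mcoeffX.
have [<-|mp] := eqVneq m p; first by rewrite mulr1.
rewrite mulr0; apply: memN_msupp_eq0; apply/negP => /hu /zdeg_inj pm.
by rewrite pm eqxx in mp.
Qed.

Lemma quo_piece_is_kP I d : monomial_ideal I ->
  quo_piece_is_k I d <-> exists2 m, zdeg m = d & ~ I 'X_[m].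
Proof.
move=> hI; split=> [[u [hu Iu _]]|[m <- Im]].
  (* Since [u] is not in [I], it is nonzero and has a monomial, which must have degree [d]. *)
  case E: (msupp u) => [|m s].
    by case: Iu; move/eqP: E; rewrite msupp_eq0 => /eqP ->; apply: monomial_ideal0.
  have dm : zdeg m = d by apply: hu; rewrite E mem_head.
  exists m => // Im; apply: Iu; rewrite -dm in hu.
  by rewrite (homogeneousX _ _ hu) -mul_mpolyC; apply: monomial_idealMl.
exists 'X_[m]; split=> // [p|v hv]; first by rewrite msuppX inE => /eqP ->.
exists v@_m; rewrite [X in X - _](homogeneousX _ _ hv) mul_mpolyC subrr.
exact: monomial_ideal0.
Qed.

Lemma tofracX_neq0 m : tofrac 'X_[m] != 0 :> frac.
Proof. by rewrite tofrac_eq0 -msupp_eq0 msuppX. Qed.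

Lemma laurent_monomialB p q :
  laurent_monomial k (zdeg p - zdeg q) = tofrac 'X_[p] / tofrac 'X_[q].
Proof.
rewrite !mpolyXE_id !rmorph_prod -prodfV -big_split /=; apply: eq_bigr => i _.
by rewrite !ffunE expfzDr ?tofracX_neq0 // -invr_expz -!exprnP !tofracXn.
Qed.

Lemma localizedMX (p : S) F m :
  supp m \subset F -> localized F (tofrac p / tofrac 'X_[m] : frac).
Proof. by move=> mF; exists p, m. Qed.

Lemma sub_localized F G (z : frac) : F \subset G -> localized F z -> localized G z.
Proof. by move=> FG [p [m [mF ->]]]; exists p, m; split=> //; apply: subset_trans FG. Qed.

Lemma localized_scaler F (c : k) (z : frac) :
  localized F z -> localized F (frac_scalar n c * z).
Proof.
move=> [p [m [mF ->]]]; exists (c%:MP_[n] * p), m.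
by rewrite tofracM mulrA.
Qed.

Lemma localized_laurent F a :
  supp (neg_part a) \subset F -> localized F (laurent_monomial k a).
Proof. by move=> aF; rewrite (zdeg_pos_neg _ a) laurent_monomialB; apply: localizedMX. Qed.

(** Clearing denominators gives c x^(a_+ + m) = p x^(a_-) with [supp m] inside [F]. Hence a_- <= a_+
    + m, and as a_+ and a_- have disjoint supports, supp a_- lies in [supp m]. *)
Lemma localized_laurent_supp F (c : k) a : c != 0 ->
  localized F (frac_scalar n c * laurent_monomial k a) ->
  supp (neg_part a) \subset F.
Proof.
move=> c0 [p [m [/subsetP mF]]]; rewrite {1}(zdeg_pos_neg _ a) laurent_monomialB.
set r := neg_part (- a); set q := neg_part a => /eqP.
rewrite /frac_scalar mulrA eqr_div ?tofracX_neq0 // -!tofracM tofrac_eq => /eqP.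
rewrite -mulrA -mpolyXD mul_mpolyC => E.
(* The monomial on the left survives because [c] is nonzero; on the right every exponent is a
   multiple of [q]. *)
have : (r + m)%MM \in msupp (p * 'X_[q]).
  by rewrite -E mcoeff_msupp mcoeffZ mcoeffX eqxx mulr1.
rewrite (perm_mem (msuppMX _ _)) => /mapP [s _ /mnmP rm].
apply/subsetP => i; move: (mF i) (rm i); rewrite !inE !mnmDE !neg_partE !ffunE.
by case: (a i) => [[|x]|x]; case: (i \in F) => /=; lia.
Qed.

Lemma localized_piece_is_kP I F a :
  localized_piece_is_k I F a <->
  supp (neg_part a) \subset F /\ ~ localized_ideal I F (laurent_monomial k a).
Proof.
split=> [[u [[Fu [c Eu]] Iu _]]|[aF Ia]].
  subst u.
  have c0 : c != 0.
    apply/eqP => c0; apply: Iu; rewrite c0 /frac_scalar tofrac0 mul0r.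
    exact: ideal_gen0.
  split; first exact: localized_laurent_supp c0 Fu.
  by move=> Ia; apply/Iu/ideal_genMl => // s; apply: localized_scaler.
exists (laurent_monomial k a); split=> //.
  split; first exact: localized_laurent.
  by exists 1; rewrite /frac_scalar tofrac1 mul1r.
by move=> v [_ [c ->]]; exists c; rewrite subrr; apply: ideal_gen0.
Qed.

Lemma cech_complex_simplicial I a : simplicial_complex (cech_complex I a).
Proof.
move=> H G GH [F [/localized_piece_is_kP [aF Ia] EH]]; subst H.
have [GF Ga] : G \subset F /\ [disjoint G & supp (neg_part a)].
  by apply/andP; rewrite -subsetD.
(* The smallest localization containing x^a that yields the face [G]. It inverts only variables of
   [F], so its extension of [I] lies in that of [F]. *)
exists (G :|: supp (neg_part a)); split; last first.
  by rewrite setDUl setDv setU0; apply/esym/setDidPl.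
apply/localized_piece_is_kP; split; first exact: subsetUr.
move=> IG; apply: Ia; apply: sub_ideal_gen IG => s.
by apply: sub_localized; rewrite subUset GF.
Qed.

Lemma koszul_complex_simplicial I b :
  monomial_ideal I -> simplicial_complex (koszul_complex I b).
Proof.
move=> hI F G GF [Fb IF]; split; first exact: subset_trans Fb.
move=> IG; apply: IF.
(* The monomial of the larger set is a multiple of that of [G]. *)
have -> : mesym1 F = (mesym1 G + mesym1 (F :\: G))%MM.
  apply/mnmP => i; rewrite !mnmE !inE; move/subsetP/(_ i): GF.
  by case: (i \in G) => [->|].
by rewrite addmA mpolyXD mulrC; apply: monomial_idealMl.
Qed.

Lemma koszul_complexP I b G : monomial_ideal I ->
  koszul_complex I b G <->
  exists F, quo_piece_is_k I (zdeg b - [ffun=> 1] + zdeg (mesym1 F)) /\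
            G = F :\: ~: supp b.
Proof.
move=> hI; split=> [[Gb IG]|[F [/(quo_piece_is_kP _ _ hI)[m Em Im] ->]]].
  (* Adding all of supp a_- to [G] makes the degree natural; removing it gives [G] back because [G]
     lies in [supp b]. *)
  have GE : (G :|: ~: supp b) :\: ~: supp b = G.
    by rewrite setDUl setDv setU0 setDE setCK; apply/setIidPl.
  exists (G :|: ~: supp b); split=> //; apply/quo_piece_is_kP => //.
  exists (b - mesym1 (supp b) + mesym1 G)%MM => //.
  by rewrite zdeg_sub1_mesym1 ?GE ?subsetUr.
split; first by rewrite setDE setCK subsetIr.
(* The mere existence of [m] puts supp a_- inside [F], which then identifies [m]. *)
have := zdeg_sub1_mesym1 _ _ _ (zdeg_sub1_mesym1_ge0 _ _ _ _ (esym Em)).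
by rewrite -Em => /zdeg_inj <-.
Qed.

Lemma cech_sub_koszul I b G :
  cech_complex I (zdeg b - [ffun=> 1]) G -> koszul_complex I b G.
Proof.
move=> [F [/localized_piece_is_kP [aF Ia] ->]]; move: aF.
rewrite supp_neg_part_sub1 => bF; split; first by rewrite setDE setCK subsetIr.
move=> IF; apply: Ia.
(* Writing a as (a + F) - F exhibits x^a as a monomial of [I] times 1 / x^F, an element of S_F. *)
rewrite -[_ - [ffun=> 1]](addrK (zdeg (mesym1 F))) zdeg_sub1_mesym1 //.
rewrite laurent_monomialB mulrC -[X in X * _]mul1r -tofrac1.
apply: ideal_gen_mem; first by apply: localizedMX; rewrite supp_mesym1.
by eexists; [exact: IF|].
Qed.

End Pieces.

Theorem lemma7p2 (k : fieldType) (n : nat) (I : {mpoly k[n]} -> Prop)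
    (hI : monomial_ideal I) (b : 'X_{1..n}) (a : {ffun 'I_n -> int})
    (ha : a = zdeg b - [ffun=> 1]) :
  (forall G : {set 'I_n},
     koszul_complex I b G <->
     exists F : {set 'I_n},
       quo_piece_is_k I (a + zdeg (mesym1 F)) /\ G = F :\: supp (neg_part a))
  /\ subcomplex (cech_complex I a) (koszul_complex I b).
Proof.
rewrite ha supp_neg_part_sub1; split=> [G|]; first exact: koszul_complexP.
split; [exact: cech_complex_simplicial | exact: koszul_complex_simplicial |].
by move=> F; apply: cech_sub_koszul.
Qed.
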